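(* Let $G$ be a simple graph with $\chi(G)$ finite, $k\in\mathbb{Z}$ and $n\in\mathbb{Z}^+$. Then a proper closed coloring with remainder $k\bmod n$ of $G$ exists if and only if a closed coloring with remainder $k\bmod n$ of $G$ exists. In that case $\chi_{n,k}(G)\le n\,\chi(G)$; more precisely, if $\ell$ is any closed coloring with remainder $k\bmod n$ of $G$, then $\chi_{n,k}(G)\le|\ell|\,\chi(G)$.
   Context: Graphs are simple, possibly infinite, $G=(V,E)$. A labeling is a map $\ell:V\to\mathbb{Z}$; its order $|\ell|$ is the size of its image; it is proper if adjacent vertices get different labels; $\chi(G)$ is the minimum order of a proper labeling. $N[v]$ is the closed neighborhood of $v$. A closed coloring with remainder $k\bmod n$ is a labeling with $\sum_{w\in N[v]}\ell(w)\equiv k\pmod n$ for all $v\in V$. When proper such colorings exist, $\chi_{n,k}(G)$ is the minimum order of a proper closed coloring with remainder $k\bmod n$ ($\infty$ if only infinite-order ones exist). *)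

(* Defs.v *)
From mathcomp Require Import all_boot all_order all_algebra finmap.
From mathcomp Require Import boolp classical_sets functions cardinality fsbigop.
From mathcomp Require Import constructive_ereal.

Set Implicit Arguments.
Unset Strict Implicit.
Unset Printing Implicit Defensive.

Import Order.TTheory GRing.Theory Num.Theory.

Local Open Scope classical_set_scope.
Local Open Scope ring_scope.

Record sgraph := SGraph {
  vertex :> choiceType;
  adj : vertex -> vertex -> Prop;
  adj_sym : forall u v, adj u v -> adj v u;
  adj_irrefl : forall v, ~ adj v v
}.

Definition closed_nbhd (G : sgraph) (v : G) : set G :=
  [set w | w = v \/ adj v w].

Definition proper_labeling (G : sgraph) (l : G -> int) : Prop :=
  forall u v : G, adj u v -> l u <> l v.

(** The sum over [closed_nbhd v] only has a meaning when that set is finite;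
    [fsbigop] would silently return a default value otherwise, so finiteness is
    part of the definition. *)
Definition closed_coloring (G : sgraph) (n : nat) (k : int) (l : G -> int) :
    Prop :=
  forall v : G, finite_set (closed_nbhd v) /\
    (\sum_(w \in closed_nbhd v) l w = k %[mod n%:Z])%Z.

Definition proper_closed_coloring (G : sgraph) (n : nat) (k : int)
    (l : G -> int) : Prop :=
  proper_labeling l /\ closed_coloring n k l.

(** Orders are natural numbers or infinity, encoded in the extended integers. *)
Definition label_order (G : sgraph) (l : G -> int) : \bar int :=
  if `[< finite_set (range l) >] then (#|` fset_set (range l)|%:Z)%:E else +oo%E.

(** The minimum order of the labelings in [P]; [+oo] when [P] is empty. *)
Definition min_order (G : sgraph) (P : set (G -> int)) : \bar int :=
  let orders := [set label_order l | l in P] in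
  xget +oo%E (orders `&` lbound orders).

Definition chi (G : sgraph) : \bar int := min_order (@proper_labeling G).

Definition chi_closed (G : sgraph) (n : nat) (k : int) : \bar int :=
  min_order (@proper_closed_coloring G n k).

(* Main.v *)
(** A closed coloring stays one when the labels are changed within their residue
    classes mod [n]. Adding to a closed coloring [l] with values in
    [(-N, N)] the multiple [2 N n p] of a proper labeling [p] of minimum order
    makes it proper, and the new label of a vertex depends only on its [l]-label
    and its [p]-label, which bounds the number of labels by the product.
    Reducing [l] mod [n] first gives a closed coloring with at most [n] labels. *)

Require Import Defs.
From mathcomp Require Import all_boot all_order all_algebra.
From mathcomp Require Import constructive_ereal.
From mathcomp Require Import finmap boolp classical_sets functions cardinality.
From mathcomp Require Import fsbigop zify.

Set Implicit Arguments.
Unset Strict Implicit.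
Unset Printing Implicit Defensive.

Import Order.TTheory GRing.Theory Num.Theory.

Section MinOrder.
Variable G : sgraph.
Local Open Scope classical_set_scope.
Local Open Scope ring_scope.

Lemma label_order_finite (l : G -> int) : finite_set (range l) ->
  label_order l = (#|` fset_set (range l)|%:Z)%:E.
Proof. by move=> fl; rewrite /label_order; case: asboolP. Qed.

Lemma label_order_infinite (l : G -> int) : ~ finite_set (range l) ->
  label_order l = +oo%E.
Proof. by move=> fl; rewrite /label_order; case: asboolP. Qed.

(** Infinite order makes the bound trivial. Otherwise some order is a natural number, so
    well-ordering gives a least one, and [xget] does not fall back on its default [+oo]. *)
Lemma min_order_le (P : set (G -> int)) (l : G -> int) :
  P l -> (min_order P <= label_order l)%E.
Proof.
move=> Pl.
have [fl|/label_order_infinite->] := pselect (finite_set (range l)); last first.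
  exact: leey.
have [x xmin] : (([set label_order l | l in P] : set (\bar int)) `&`
                 lbound [set label_order l | l in P]) !=set0.
  pose Q m := `[< exists2 l', P l' & label_order l' = (m%:Z)%:E >].
  have exQ : exists m, Q m.
    exists #|` fset_set (range l)|; apply/asboolP.
    by exists l => //; exact: label_order_finite.
  case: (ex_minnP exQ) => m /asboolP[l' Pl' l'm] minm.
  exists (m%:Z)%:E; split; first by exists l'.
  (* [m] is least among the finite orders only; infinite ones lie above it anyway. *)
  move=> _ [l2 Pl2 <-].
  have [fl2|/label_order_infinite->] := pselect (finite_set (range l2)).
    rewrite label_order_finite // lee_fin lez_nat; apply: minm.
    by apply/asboolP; exists l2 => //; exact: label_order_finite.
  exact: leey.
have [_ +] := xgetPex +oo%E (ex_intro _ x xmin).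
by apply; exists l.
Qed.

(** A finite value cannot be the default [+oo] of [xget], so it is the order of some labeling in
    [P]; that order being finite, so is the range. *)
Lemma min_order_attained (P : set (G -> int)) : min_order P \is a fin_num ->
  exists2 l, P l & finite_set (range l) /\ label_order l = min_order P.
Proof.
rewrite /min_order; case: xgetP => [_ -> [[l Pl <-] _] fin|_]; last by [].
exists l => //; split=> //; apply: contrapT => /label_order_infinite lE.
by rewrite lE in fin.
Qed.

End MinOrder.

Lemma leq_card_fset_set_image (T U : choiceType) (f : T -> U) (A : set U)
    (B : set T) :
  finite_set B -> (A `<=` f @` B)%classic ->
  (#|` fset_set A| <= #|` fset_set B|)%N.
Proof.
move=> fB sAB; have ffB : finite_set (f @` B)%classic by exact: finite_image.
move: (sAB); rewrite fset_set_sub //; last exact: sub_finite_set sAB ffB.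
move=> /fsubset_leq_card/leq_trans; apply.
by rewrite fset_set_image // leq_imfset_card.
Qed.

Lemma leq_card_fsetM (T U : choiceType) (A : {fset T}) (B : {fset U}) :
  (#|` (A `*` B)%fset| <= #|` A| * #|` B|)%N.
Proof.
rewrite -(size_allpairs pair); apply: uniq_leq_size => // -[x y].
rewrite in_fsetM => /andP[xA yB].
by apply/allpairsP; exists (x, y).
Qed.

Lemma finite_set_int_bounded (A : set int) : finite_set A ->
  exists N : nat, forall x, A x -> (`|x| < N%:Z)%R.
Proof.
(* The successor makes the bound strict, so that two elements of [A] differ by less than [2 * N]. *)
move=> fA; exists (\max_(x <- fset_set A) `|x|%N).+1 => x Ax.
have xA : x \in fset_set A by rewrite in_fset_set // inE.
rewrite -abszE ltz_nat ltnS.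
exact: (leq_bigmax_seq x (P := xpredT) (F := absz) xA isT).
Qed.

Section ClosedColoring.
Variables (G : sgraph) (n : nat) (k : int).
Local Open Scope classical_set_scope.
Local Open Scope ring_scope.

Lemma closed_coloring_congr (l l' : G -> int) :
  (forall v, (l' v = l v %[mod n%:Z])%Z) ->
  closed_coloring n k l -> closed_coloring n k l'.
Proof.
move=> ll' cl v; have [fv lv] := cl v; split=> //; rewrite -lv.
rewrite !fsbig_finite //=.
(* Congruence mod [n] is compatible with addition, hence passes from the terms to the sums. *)
apply: (big_ind2 (fun x y => (x = y %[mod n%:Z])%Z)) => // x1 x2 y1 y2 e1 e2.
by rewrite -modzDm e1 e2 modzDm.
Qed.

Lemma closed_coloring_modz (l : G -> int) :
  closed_coloring n k l -> closed_coloring n k (fun v => (l v %% n%:Z)%Z).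
Proof. by apply: closed_coloring_congr => v; rewrite modz_mod. Qed.

Lemma range_modz_sub (l : G -> int) : (0 < n)%N ->
  range (fun v => (l v %% n%:Z)%Z) `<=` Posz @` `I_n.
Proof.
move=> n0 _ [v _ <-]; have n0' : n%:Z != 0 by lia.
have := modz_ge0 (l v) n0'; have := ltz_pmod (l v) (d := n%:Z) ltac:(lia).
by case: (modz _ _) => // m ltmn _; exists m.
Qed.

Lemma finite_range_modz (l : G -> int) : (0 < n)%N ->
  finite_set (range (fun v => (l v %% n%:Z)%Z)).
Proof.
move=> n0; apply: sub_finite_set (@range_modz_sub l n0) _.
exact/finite_image/finite_II.
Qed.

Lemma label_order_modz (l : G -> int) : (0 < n)%N ->
  (label_order (fun v => (l v %% n%:Z)%Z) <= (n%:Z)%:E)%E.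
Proof.
move=> n0; rewrite label_order_finite; last exact: finite_range_modz.
rewrite lee_fin lez_nat.
rewrite -[leqRHS](card_fset_set (card_eqxx `I_n)).
exact: leq_card_fset_set_image (finite_II n) (@range_modz_sub l n0).
Qed.

(** Finiteness of [range l] supplies the bound [N]. A closed coloring of infinite order is first
    reduced mod [n]. *)
Lemma proper_closed_of_finite (l p : G -> int) :
  (0 < n)%N -> closed_coloring n k l -> proper_labeling p ->
  finite_set (range l) -> finite_set (range p) ->
  exists2 L : G -> int, proper_closed_coloring n k L &
    (label_order L <= label_order l * label_order p)%E.
Proof.
move=> n0 cl pp fl fp; have [N Nl] := finite_set_int_bounded fl.
pose f (ab : int * int) : int := ab.1 + 2 * N%:Z * ab.2 * n%:Z.
exists (fun v => f (l v, p v)).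
  split.
    move=> u v uv /eqP; rewrite /f /= => fuv; apply: (pp _ _ uv).
    have := Nl _ (imageT l u); have := Nl _ (imageT l v) => lv lu.
    have {}fuv : l u - l v = 2 * N%:Z * n%:Z * (p v - p u) by lia.
    (* If [p u] and [p v] differed, the right-hand side of [fuv] would have absolute value at least
       [2 * N], while [l u] and [l v] both lie strictly between [-N] and [N]. *)
    apply: contrapT => /eqP puv.
    have : 2 * N%:Z <= `|l u - l v|.
      rewrite fuv normrM ger0_norm; last by nia.
      apply: (@le_trans _ _ (2 * N%:Z * n%:Z)); first by nia.
      by rewrite ler_peMr; [|nia|rewrite -gtz0_ge1 normr_gt0 subr_eq0 eq_sym].
    by lia.
  by apply: closed_coloring_congr cl => v; rewrite /f /= addrC modzMDl.
(* The new labels are images under [f] of pairs of old labels, so counting pairs bounds the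
   order. *)
have fM : finite_set (range l `*` range p) by exact: finite_setX.
have sub : range (fun v => f (l v, p v)) `<=` f @` (range l `*` range p).
  by move=> _ [v _ <-]; exists (l v, p v).
have fL : finite_set (range (fun v => f (l v, p v))).
  by apply: sub_finite_set sub _; exact: finite_image.
rewrite !label_order_finite // -EFinM lee_fin -PoszM lez_nat.
rewrite (leq_trans (leq_card_fset_set_image fM sub)) // fset_setX //.
exact: leq_card_fsetM.
Qed.

End ClosedColoring.

Theorem theorem3p5 (G : sgraph) (k : int) (n : nat)
  (hchi : chi G \is a fin_num) (hn : (0 < n)%N) :
  ((exists l : G -> int, proper_closed_coloring n k l) <->
   (exists l : G -> int, closed_coloring n k l)) /\
  ((exists l : G -> int, closed_coloring n k l) ->
   (chi_closed G n k <= (Posz n)%:E * chi G)%E) /\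
  (forall l : G -> int, closed_coloring n k l ->
   (chi_closed G n k <= label_order l * chi G)%E).
Proof.
have [p pp [fp pE]] := min_order_attained hchi.
rewrite -/(chi G) in pE.
have chi0 : (0 <= chi G)%E by rewrite -pE label_order_finite // lee_fin.
have chi_closed_le (l : G -> int) : closed_coloring n k l ->
    finite_set (range l) -> (chi_closed G n k <= label_order l * chi G)%E.
  move=> cl fl; have [L cL leL] := proper_closed_of_finite hn cl pp fl fp.
  by rewrite -pE; apply: le_trans leL; exact: min_order_le.
have chi_closed_le_n (l : G -> int) : closed_coloring n k l ->
    (chi_closed G n k <= (Posz n)%:E * chi G)%E.
  (* The residues of [l] have finite range, so the product bound applies to them whatever the order
     of [l]. *)
  move=> /closed_coloring_modz/chi_closed_le.
  move=> /(_ (finite_range_modz l hn))/le_trans; apply.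
  by apply: lee_wpmul2r => //; exact: label_order_modz.
split; [split|split].
- by move=> [l [_ cl]]; exists l.
- move=> [l /closed_coloring_modz cl].
  have [L cL _] := proper_closed_of_finite hn cl pp (finite_range_modz l hn) fp.
  by exists L.
- by move=> [l /chi_closed_le_n].
move=> l cl; have [fl|nfl] := pselect (finite_set (range l)).
  exact: chi_closed_le.
(* As [+oo * 0 = 0], the case [chi G = 0] is separate. *)
rewrite label_order_infinite //; have [chi_eq0|chi_neq0] := eqVneq (chi G) 0%E.
  (* Here the bound by [n] times [chi G] is also 0. *)
  by have := chi_closed_le_n _ cl; rewrite chi_eq0 !mule0.
by rewrite gt0_mulye ?leey // lt_neqAle eq_sym chi_neq0.
Qed.
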